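(* Let $n\ge 0$ be an integer, and let $A(2n,3|0)$ be the set of lattice paths of length $2n$ which start at $(0,0)$, end on height $0$, and are contained in the strip $-2\le y\le 1$. Every path $P\in A(2n,3|0)$ can be written uniquely as $P=\mathbf{w}_0\,(UD)\,\mathbf{w}_1\,(UD)\cdots(UD)\,\mathbf{w}_s$ with $s\ge 0$, where each displayed $UD$ is a pair of steps going from height $0$ to height $1$ and back to height $0$, and each $\mathbf{w}_i$ is a (possibly empty) path from height $0$ to height $0$ contained in the strip $-2\le y\le 0$. Each $\mathbf{w}_i$ is cut at its returns to height $0$ into a sequence of sojourns of the form $D(DU)^{m-1}U$ with $m\ge 1$; let $\tau(\mathbf{w}_i)$ be the word obtained from $\mathbf{w}_i$ by replacing each sojourn $D(DU)^{m-1}U$ by the symbol $\mathbf{p}_m$. Then the map $$P\longmapsto \mathbf{a}\,\tau(\mathbf{w}_0)\,\mathbf{a}\,\tau(\mathbf{w}_1)\,\mathbf{a}\cdots\mathbf{a}\,\tau(\mathbf{w}_s)\,\mathbf{a}$$ is a bijection from $A(2n,3|0)$ onto the set of Elena trees of size $n+2$.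
   Context: A lattice path of length $N$ is a sequence of $N$ steps starting at $(0,0)$, each being an up step $U:(i,j)\to(i+1,j+1)$ or a down step $D:(i,j)\to(i+1,j-1)$; the height of a point $(i,j)$ is $j$, and a path is contained in a strip $a\le y\le b$ if all of its points have height in $[a,b]$. An Elena tree consists of a nonempty chain of nodes labelled $\mathbf{a}$ (consecutive ones joined by an edge), with a finite, possibly empty, ordered sequence of paths of various lengths emanating from each $\mathbf{a}$-node except the last one. The symbol $\mathbf{p}_m$ ($m\ge 1$) denotes a path with $m$ edges hanging from an $\mathbf{a}$-node, thus contributing $m$ new nodes. An Elena tree is described by (and identified with) the word listing the $\mathbf{a}$-nodes in order, each followed by the sequence of its emanating paths; thus Elena trees are exactly the words in the language $(\mathbf{a}\,\mathbf{p}^* )^*\mathbf{a}$, where $\mathbf{p}$ stands for any of the symbols $\mathbf{p}_1,\mathbf{p}_2,\mathbf{p}_3,\dots$. The size of an Elena tree is its number of nodes, i.e. the number of symbols $\mathbf{a}$ plus the sum of the indices $m$ over all symbols $\mathbf{p}_m$ occurring in the word. *)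

(* Defs.v *)
From Stdlib Require List.
From mathcomp Require Import all_boot all_order all_algebra.
From mathcomp Require Import classical_sets functions.
Set Implicit Arguments.
Unset Strict Implicit.
Unset Printing Implicit Defensive.
Import Order.TTheory GRing.Theory Num.Theory.
Local Open Scope ring_scope.

Inductive step := U | D.

Definition lpath := seq step.

Definition dy (s : step) : int := if s is U then 1 else - 1.

(* Height of the last point, for a path starting at height 0.  The successive
   points of [P] have heights [height (take k P)], [0 <= k <= size P]. *)
Definition height (P : lpath) : int := \sum_(s <- P) dy s.

Definition in_strip (a b : int) (P : lpath) : bool :=
  [forall k : 'I_(size P).+1, a <= height (take k P) <= b].

(* A(2n,3|0) *)
Definition A3 (n : nat) : set lpath :=
  [set P | [/\ size P = (2 * n)%N, height P = 0 & in_strip (- 2) 1 P]]%classic.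

Definition low_loop (w : lpath) : bool :=
  (height w == 0) && in_strip (- 2) 0 w.

(* P = w_0 (UD) w_1 (UD) ... (UD) w_s, where [w0] is w_0 and [ws] lists
   w_1, ..., w_s.  Since every w_i goes from height 0 to height 0, each of the
   displayed factors UD leaves from height 0. *)
Definition UD_decomposition (P w0 : lpath) (ws : seq lpath) : Prop :=
  [/\ low_loop w0, all low_loop ws
    & P = w0 ++ flatten [seq [:: U; D] ++ w | w <- ws]].

(* A nonempty path from height 0 to height 0 with no interior point at
   height 0. *)
Definition is_sojourn (q : lpath) : bool :=
  [&& (0 < size q)%N, height q == 0
    & [forall k : 'I_(size q), (0 < k)%N ==> (height (take k q) != 0)]].

Definition cut_at_returns (w : lpath) (qs : seq lpath) : Prop :=
  w = flatten qs /\ all is_sojourn qs.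

(* D (DU)^(m-1) U; only used for m >= 1. *)
Definition sojourn (m : nat) : lpath :=
  D :: flatten (nseq m.-1 [:: D; U]) ++ [:: U].

(* [p m] is the symbol p_m; the requirement m >= 1 is imposed wherever such
   symbols are introduced ([is_elena], [tau]). *)
Inductive letter := a | p of nat.

Definition word := seq letter.

(* [tau w t] says that t is the word tau(w). *)
Definition tau (w : lpath) (t : word) : Prop :=
  exists ms : seq nat,
    [/\ all (leq 1) ms, cut_at_returns w [seq sojourn m | m <- ms]
      & t = [seq p m | m <- ms]].

(* The graph of P |-> a tau(w_0) a tau(w_1) a ... a tau(w_s) a, with [t0] and
   [ts] standing for tau(w_0) and tau(w_1), ..., tau(w_s). *)
Definition elena_graph (P : lpath) (W : word) : Prop :=
  exists (w0 : lpath) (ws : seq lpath) (t0 : word) (ts : seq word),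
    [/\ UD_decomposition P w0 ws, tau w0 t0, List.Forall2 tau ws ts
      & W = (a :: t0) ++ flatten [seq a :: t | t <- ts] ++ [:: a]].

(* Elena trees, identified with the words of the language (a p* )* a. *)
Definition is_elena (W : word) : Prop :=
  exists2 mss : seq (seq nat), all (all (leq 1)) mss
    & W = flatten [seq a :: [seq p m | m <- ms] | ms <- mss] ++ [:: a].

(* The number of nodes. *)
Definition elena_size (W : word) : nat :=
  (\sum_(l <- W) if l is p m then m else 1)%N.

Definition elena_trees (N : nat) : set word :=
  [set W | is_elena W /\ elena_size W = N]%classic.

(* Main.v *)
Require Import Defs.
From mathcomp Require Import all_boot all_order all_algebra.
From mathcomp Require Import classical_sets functions.
From mathcomp Require boolp.
Set Implicit Arguments.
Unset Strict Implicit.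
Unset Printing Implicit Defensive.
Import Order.TTheory GRing.Theory Num.Theory.

(** The bijection is a letter-by-letter substitution.  Replace each letter of a
    word [t] by a block, namely [a] by [UD] and [p m] by the sojourn
    [D (DU)^(m-1) U], and call the resulting path [expand t].

    A path in the strip [-2 <= y <= 1] that returns to height 0 is cut at its
    returns into excursions.  Above the axis the only excursion that fits is
    [UD]; below the axis, a path that has reached height -1 can only dip to -2
    and come back any number of times before it returns, so the excursion is
    [D (DU)^(m-1) U] for some [m >= 1].  Hence every such path is [expand t] for
    some [t] with positive indices ([closed_path_expand]).  No block is a proper
    prefix of another one, because a sojourn does not touch height 0 inside, so
    [t] is unique ([expand_inj]).

    On the other side, an Elena word with at least two nodes is exactly a word
    [a t a] with [t] as above: cutting [t] at its letters [a] ([strands], with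
    inverse [join]) yields the words tau(w_i), and low loops are the expansions
    of words without [a] ([low_loopP]).  So the graph of the map is
    [expand t |-> a t a] ([elena_graphP]).  As a block has twice as many steps as
    its letter has nodes, length [2n] corresponds to size [n] for [t], that is
    [n + 2] for [a t a]. *)

(** * Heights and strips *)

Lemma height_nil : height [::] = 0%R.
Proof. by rewrite /height big_nil. Qed.

Lemma height_cons s P : height (s :: P) = (dy s + height P)%R.
Proof. by rewrite /height big_cons. Qed.

Lemma height_cat P Q : height (P ++ Q) = (height P + height Q)%R.
Proof. by rewrite /height big_cat. Qed.

(** The starting height [h] is a parameter so that an induction on the path, or a
    cut of the path, can move it. *)
Fixpoint confined (lo hi h : int) (P : lpath) : bool :=
  (lo <= h <= hi)%R && (if P is s :: P' then confined lo hi (h + dy s)%R P'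
                        else true).

Lemma confined_take lo hi h P k :
  confined lo hi h P -> (lo <= h + height (take k P) <= hi)%R.
Proof.
elim: P h k => [|s P IH] h [|k] /=; rewrite ?height_nil ?addr0.
- by case/andP.
- by case/andP.
- by case/andP.
- by case/andP=> _ /IH; rewrite height_cons addrA; apply.
Qed.

Lemma confined_start lo hi h P : confined lo hi h P -> (lo <= h <= hi)%R.
Proof. by case: P => [|s P] /andP[]. Qed.

Lemma take_confined lo hi h P :
  (forall k, k <= size P -> (lo <= h + height (take k P) <= hi)%R) ->
  confined lo hi h P.
Proof.
elim: P h => [|s P IH] h /= H.
  by have := H 0 isT; rewrite height_nil addr0 => ->.
apply/andP; split; first by have := H 0 isT; rewrite height_nil addr0.
apply: IH => k lek; have := H k.+1 lek.
by rewrite /= height_cons addrA.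
Qed.

Lemma in_stripE lo hi P : in_strip lo hi P = confined lo hi 0%R P.
Proof.
apply/forallP/idP => [H|H k]; last first.
  by have := confined_take k H; rewrite add0r.
apply: take_confined => k lek; rewrite add0r.
by have := H (inord k); rewrite inordK.
Qed.

Lemma confinedW lo hi hi' h P :
  (hi <= hi')%R -> confined lo hi h P -> confined lo hi' h P.
Proof.
move=> le_hi; elim: P h => [|s P IH] h /=.
  by rewrite !andbT => /andP[-> /le_trans]; apply.
by case/andP=> /andP[-> /le_trans-> //=]; apply: IH.
Qed.

(** * Blocks *)

(** The paths from height -1 to itself through height -2. *)
Definition dips (k : nat) : lpath := flatten (nseq k [:: D; U]).

Definition block (l : letter) : lpath :=
  if l is p m then sojourn m else [:: U; D].

Definition expand (t : word) : lpath := flatten [seq block l | l <- t].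

(** The letters that may occur strictly inside an Elena word; [hair] selects
    those that come from the tau(w_i). *)
Definition good (l : letter) : bool := if l is p m then 0 < m else true.

Definition hair (l : letter) : bool := if l is p m then 0 < m else false.

Lemma hair_good l : hair l -> good l.
Proof. by case: l. Qed.

Lemma all_hairP t :
  all hair t <-> exists2 ms, all (leq 1) ms & t = [seq p m | m <- ms].
Proof.
split=> [|[ms]]; last by move=> + ->; rewrite all_map.
elim: t => [|[|m] t IH] //=; first by exists [::].
by case/andP=> m_gt0 /IH[ms ms_gt0 ->]; exists (m :: ms); rewrite //= m_gt0.
Qed.

Lemma expand_cons l t : expand (l :: t) = block l ++ expand t.
Proof. by []. Qed.

Lemma expand_cat t u : expand (t ++ u) = expand t ++ expand u.
Proof. by rewrite /expand map_cat flatten_cat. Qed.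

Lemma expand_p ms : expand [seq p m | m <- ms] = flatten [seq sojourn m | m <- ms].
Proof. by rewrite /expand -map_comp. Qed.

Lemma height_dips k : height (dips k) = 0%R.
Proof.
by elim: k => [|k IH]; rewrite /dips /= ?height_nil // !height_cons IH.
Qed.

Lemma height_block l : height (block l) = 0%R.
Proof.
case: l => [|m] /=; first by rewrite !height_cons height_nil.
by rewrite /sojourn height_cons height_cat height_dips height_cons height_nil.
Qed.

Lemma height_expand t : height (expand t) = 0%R.
Proof.
elim: t => [|l t IH]; first by rewrite height_nil.
by rewrite /expand /= height_cat height_block IH.
Qed.

Lemma size_dips k : size (dips k) = (2 * k)%N.
Proof. by elim: k => // k IH; rewrite /dips /= IH mulnS. Qed.

Lemma size_sojourn m : 0 < m -> size (sojourn m) = (2 * m)%N.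
Proof. by case: m => // m _; rewrite /= size_cat size_dips addn1 mulnS. Qed.

Lemma elena_size_cons l t :
  elena_size (l :: t) = ((if l is p m then m else 1) + elena_size t)%N.
Proof. by rewrite /elena_size big_cons. Qed.

Lemma elena_size_ends t : elena_size (a :: t ++ [:: a]) = (elena_size t + 2)%N.
Proof.
rewrite elena_size_cons /elena_size big_cat big_seq1 /=.
by rewrite addnC -addnA.
Qed.

Lemma size_expand t : all good t -> size (expand t) = (2 * elena_size t)%N.
Proof.
elim: t => [|l t IH] /=; first by rewrite /elena_size big_nil.
case/andP=> good_l /IH; rewrite /expand /= size_cat elena_size_cons mulnDr => ->.
by congr addn; case: l good_l => // m; apply: size_sojourn.
Qed.

(** A dip from height -1 visits only heights -1 and -2 and comes back, so dips
    can be inserted or removed there. *)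
Lemma confined_dips hi k P : (-1 <= hi)%R ->
  confined (-2)%R hi (-1)%R (dips k ++ P) = confined (-2)%R hi (-1)%R P.
Proof.
move=> hi_ge; elim: k => // k IH.
rewrite /dips /= -/(dips k) hi_ge.
have -> : (-1 + dy D = -2 :> int)%R by [].
have -> : (-2 + dy U = -1 :> int)%R by [].
by rewrite IH (le_trans _ hi_ge).
Qed.

Lemma confined_sojourn hi m P : (0 <= hi)%R ->
  confined (-2)%R hi 0%R (sojourn m ++ P) = confined (-2)%R hi 0%R P.
Proof.
move=> hi_ge; rewrite /sojourn /= -/(dips _) hi_ge -catA.
have hi_ge1 : (-1 <= hi)%R by apply: le_trans hi_ge.
have -> : (0 + dy D = -1 :> int)%R by [].
rewrite confined_dips //= hi_ge1.
by have -> : (-1 + dy U = 0 :> int)%R by [].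
Qed.

Lemma confined_expand t : confined (-2)%R 1%R 0%R (expand t).
Proof.
elim: t => // -[|m] t IH; last by rewrite expand_cons /block confined_sojourn.
rewrite expand_cons /=.
by have -> : (0 + dy U + dy D = 0 :> int)%R by [].
Qed.

Lemma confined_expand_low t :
  all good t -> confined (-2)%R 0%R 0%R (expand t) = all hair t.
Proof.
elim: t => // -[|m] t IH; first by case: (expand t).
case/andP=> m_gt0 /IH; rewrite expand_cons /block confined_sojourn // => ->.
by rewrite /= (m_gt0 : 0 < m).
Qed.

(** * Parsing a path into blocks *)

(** The beginning of the current block for a path that stands at height
    [h]: at heights -1 and -2, dips that are already completed are left out,
    since any number of them can be inserted again. *)
Definition stem (h : int) : lpath :=
  match h with
  | Posz 0 => [::]
  | Posz _ => [:: U]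
  | Negz 0 => [:: D]
  | Negz _ => [:: D; D]
  end.

(** Induction on the rest of the path: each step either extends the stem, closes
    a block, or completes a dip. *)
Lemma stem_expand h P :
  confined (-2)%R 1%R h P -> (h + height P = 0)%R ->
  exists2 t, all good t & stem h ++ P = expand t.
Proof.
elim: P h => [|s P IH] h /=.
  by move=> _; rewrite height_nil addr0 => ->; exists [::].
rewrite height_cons addrA => /andP[h_strip P_strip].
have next_strip := confined_start P_strip.
move=> /(IH _ P_strip)[t good_t].
move: h_strip next_strip {P_strip}.
(* The heights 2 and -3 that a step could reach are ruled out by the strip. *)
case: h => [[|[|h]]|[|[|h]]] //= _; case: s => //= _ E.
- by exists t.
- by exists t.
- by exists (a :: t) => //; rewrite E.
- by exists (p 1 :: t) => //; rewrite E.
- by exists t.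
- (* Climbing from -2 to -1 completes a dip, which is added to the block that
     starts [D :: P]. *)
  case: t good_t E => [|[|[|m]] t] //= good_t [E].
  by exists (p m.+2 :: t) => //; rewrite E.
Qed.

(** At height 0 no block has been started. *)
Lemma closed_path_expand P : in_strip (-2)%R 1%R P -> height P = 0%R ->
  exists2 t, all good t & P = expand t.
Proof.
rewrite in_stripE => P_strip hP.
by apply: (stem_expand P_strip); rewrite add0r.
Qed.

(** The only block that rises above the axis is that of [a]. *)
Lemma low_loopP w : low_loop w <-> exists2 t, all hair t & w = expand t.
Proof.
rewrite /low_loop in_stripE; split=> [/andP[/eqP hw w_low]|[t hair_t ->]].
  have [|t good_t Ew] := @closed_path_expand w _ hw.
    by rewrite in_stripE; apply: confinedW w_low.
  by exists t; rewrite // -confined_expand_low -?Ew.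
have good_t : all good t by apply: sub_all hair_t => l; apply: hair_good.
by rewrite height_expand eqxx confined_expand_low.
Qed.

(** * Uniqueness of the cutting at returns *)

Lemma block_sojourn l : good l -> is_sojourn (block l).
Proof.
case: l => [|[//|m]] /= _; rewrite /is_sojourn.
  rewrite !height_cons height_nil /=; apply/forallP => -[[|[|k]] //= _].
  by rewrite height_cons height_nil.
rewrite (height_block (p m.+1)) eqxx /=; apply/forallP => -[[|k] //= lt_k].
rewrite -/(dips m) in lt_k *.
have le_k : k <= size (dips m) by move: lt_k; rewrite size_cat addn1 !ltnS.
rewrite height_cons takel_cat //.
have low : confined (-2)%R (-1)%R (-1)%R (dips m).
  by rewrite -[dips m]cats0 confined_dips.
have /andP[_ neg] := confined_take k low.
by rewrite lt_eqF // (le_lt_trans neg).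
Qed.

(** A longer sojourn [q'] with the same beginning would touch height 0 at the end
    of [q]. *)
Lemma sojourn_prefix q q' x x' : is_sojourn q -> is_sojourn q' ->
  size q <= size q' -> q ++ x = q' ++ x' -> q = q'.
Proof.
case/and3P=> q_gt0 /eqP hq _ /and3P[_ _ /forallP q'_neq0] le_qq' E.
have Eq : q = take (size q) q'.
  by rewrite -[LHS](take_size_cat x (erefl (size q))) E takel_cat.
move: le_qq'; rewrite leq_eqVlt => /orP[/eqP Es|lt_qq'].
  by rewrite Eq Es take_size.
by have := q'_neq0 (Ordinal lt_qq'); rewrite q_gt0 /= -Eq hq eqxx.
Qed.

Lemma flatten_sojourn_inj qs qs' :
  all is_sojourn qs -> all is_sojourn qs' -> flatten qs = flatten qs' ->
  qs = qs'.
Proof.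
elim: qs qs' => [|q qs IH] [|q' qs'] //=.
- by move=> _ /andP[/and3P[]]; case: q'.
- by move=> /andP[/and3P[]]; case: q.
move=> /andP[q_s qs_s] /andP[q'_s qs'_s] E.
have Eq : q = q'.
  case/orP: (leq_total (size q) (size q')) => le_q.
    exact: sojourn_prefix le_q E.
  by apply/esym; apply: sojourn_prefix le_q (esym E).
by move: E; rewrite Eq => /(congr1 (drop (size q'))); rewrite !drop_size_cat // => /IH->.
Qed.

Lemma sojourn_inj m m' : 0 < m -> 0 < m' -> sojourn m = sojourn m' -> m = m'.
Proof.
move=> m_gt0 m'_gt0 /(congr1 size); rewrite !size_sojourn // => /eqP.
by rewrite eqn_pmul2l // => /eqP.
Qed.

Lemma map_block_inj t t' : all good t -> all good t' ->
  [seq block l | l <- t] = [seq block l | l <- t'] -> t = t'.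
Proof.
elim: t t' => [|l t IH] [|l' t'] //= /andP[gl gt] /andP[gl' gt'] [El /IH-> //].
congr cons; case: l l' gl gl' El => [|m] [|m'] //= m_gt0 m'_gt0 E.
by rewrite (sojourn_inj _ _ E).
Qed.

Lemma all_block_sojourn t :
  all good t -> all is_sojourn [seq block l | l <- t].
Proof. by rewrite all_map; apply: sub_all => l; apply: block_sojourn. Qed.

Lemma expand_inj t t' :
  all good t -> all good t' -> expand t = expand t' -> t = t'.
Proof.
move=> gt gt' E; apply: map_block_inj => //.
by apply: flatten_sojourn_inj; rewrite ?all_block_sojourn.
Qed.

Lemma cut_at_returns_unique w qs qs' :
  cut_at_returns w qs -> cut_at_returns w qs' -> qs = qs'.
Proof. by move=> [-> s] [E s']; apply: flatten_sojourn_inj. Qed.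

Lemma low_loop_cut w : low_loop w ->
  exists2 ms, all (leq 1) ms & cut_at_returns w [seq sojourn m | m <- ms].
Proof.
case/low_loopP=> t /all_hairP[ms ms_gt0 ->] ->; exists ms => //.
split; first exact: expand_p.
by rewrite all_map; apply: sub_all ms_gt0 => m; apply: (@block_sojourn (p m)).
Qed.

Lemma map_sojourn_inj ms ms' : all (leq 1) ms -> all (leq 1) ms' ->
  [seq sojourn m | m <- ms] = [seq sojourn m | m <- ms'] -> ms = ms'.
Proof.
move=> ms_gt0 ms'_gt0 E; have p_inj : injective p by move=> m m' [].
apply: (inj_map p_inj); apply: map_block_inj; rewrite ?all_map //.
by rewrite -!map_comp.
Qed.

(** * Cutting a word at the letters a *)

(** A pair [(t0, ts)] stands for [t0 a t1 a ... a tk]; as in the decomposition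
    of a path, the first strand is kept apart because it always exists. *)
Definition join (d : word * seq word) : word :=
  d.1 ++ flatten [seq a :: t | t <- d.2].

Fixpoint strands (t : word) : word * seq word :=
  match t with
  | [::] => ([::], [::])
  | a :: t' => let d := strands t' in ([::], d.1 :: d.2)
  | l :: t' => let d := strands t' in (l :: d.1, d.2)
  end.

Definition hairy (d : word * seq word) : bool :=
  all hair d.1 && all (all hair) d.2.

Lemma strandsK t : join (strands t) = t.
Proof. by elim: t => // -[|m] t /= IH; rewrite /join /= -[in RHS]IH. Qed.

Lemma joinK d : hairy d -> strands (join d) = d.
Proof.
case: d => t0 ts /andP[] /=; rewrite /join /=.
elim: ts t0 => [|t ts IH] t0 /= + +.
  by rewrite cats0 => + _; elim: t0 => [|[|m] t0 IH] //= /andP[_ /IH->].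
elim: t0 => [|[|m] t0 IH0] //= h0 hts.
  by case/andP: hts => ht hts; rewrite IH.
by case/andP: h0 => _ h0; rewrite IH0.
Qed.

Lemma hairy_strands t : all good t -> hairy (strands t).
Proof.
rewrite /hairy; elim: t => // -[|m] t IH /=; first by move/IH.
by case/andP=> m_gt0 /IH /andP[-> ->]; rewrite !andbT.
Qed.

Lemma good_join d : hairy d -> all good (join d).
Proof.
case: d => t0 ts /andP[/= h0 hts]; rewrite /join all_cat /=.
rewrite (sub_all hair_good h0) /=; elim: ts hts => //= t ts IH /andP[ht /IH].
by rewrite all_cat (sub_all hair_good ht).
Qed.

Lemma expand_join d : expand (join d) =
  expand d.1 ++ flatten [seq [:: U; D] ++ w | w <- map expand d.2].
Proof.
case: d => t0 ts; rewrite /join expand_cat /=; congr cat.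
elim: ts => //= t ts IH.
by rewrite -IH -expand_cat.
Qed.

(** Since the low loops are the expansions of the words without [a],
    decomposing a path at its factors [UD] above the axis is the same as cutting a
    word at its letters [a]; uniqueness is then [joinK]. *)
Lemma UD_decompositionP P w0 ws : UD_decomposition P w0 ws <->
  exists2 d, hairy d &
    [/\ w0 = expand d.1, ws = map expand d.2 & P = expand (join d)].
Proof.
split=> [[/low_loopP[t0 h0 ->] low_ws ->]|[d /andP[h0 hts] [-> -> ->]]].
  have [ts hts ->] : exists2 ts, all (all hair) ts & ws = map expand ts.
    elim: ws low_ws => [|w ws IH] /=; first by exists [::].
    case/andP=> /low_loopP[t ht ->] /IH[ts hts ->].
    by exists (t :: ts); rewrite //= ht.
  by exists (t0, ts); rewrite ?expand_join // /hairy h0.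
split; [by apply/low_loopP; exists d.1 | | exact: expand_join].
by rewrite all_map; apply: sub_all hts => t ht; apply/low_loopP; exists t.
Qed.

(** * The graph of the map *)

Lemma tauP w t : tau w t <-> all hair t /\ w = expand t.
Proof.
split=> [[ms [ms_gt0 [-> _] ->]]|[ht ->]].
  by rewrite expand_p; split=> //; apply/all_hairP; exists ms.
have /low_loop_cut[ms ms_gt0 cut] : low_loop (expand t).
  by apply/low_loopP; exists t.
exists ms; split=> //; apply: expand_inj; rewrite ?(sub_all hair_good) //.
  by apply/all_hairP; exists ms.
by rewrite expand_p; case: cut.
Qed.

Lemma Forall2_tauP ws ts :
  List.Forall2 tau ws ts <-> all (all hair) ts /\ ws = map expand ts.
Proof.
split=> [|[hts ->]]; first by elim=> //= w t ws' ts' /tauP[-> ->] _ [-> ->].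
elim: ts hts => //= t ts IH /andP[ht /IH]; apply: List.Forall2_cons.
exact/tauP.
Qed.

(** Expanding [a] to [UD] while leaving hairs to become sojourns turns the two
    decompositions, of [P] and of [W], into the same cutting of [t]. *)
Lemma elena_graphP P W : elena_graph P W <->
  exists2 t, all good t & P = expand t /\ W = a :: t ++ [:: a].
Proof.
split=> [[w0 [ws [t0 [ts [[_ _ ->] /tauP[h0 ->] /Forall2_tauP[hts ->] ->]]]]]|].
  exists (join (t0, ts)); first by rewrite good_join // /hairy h0.
  by rewrite expand_join /join /= catA.
case=> t good_t [-> ->]; have /andP[h0 hts] := hairy_strands good_t.
exists (expand (strands t).1), (map expand (strands t).2).
exists (strands t).1, (strands t).2; split.
- apply/UD_decompositionP; exists (strands t); first exact: hairy_strands.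
  by rewrite strandsK.
- exact/tauP.
- exact/Forall2_tauP.
- by rewrite /= catA -{1}(strandsK t).
Qed.

Lemma all_all_hairP ts : all (all hair) ts <->
  exists2 mss, all (all (leq 1)) mss & ts = [seq [seq p m | m <- ms] | ms <- mss].
Proof.
split=> [|[mss mss_gt0 ->]]; last first.
  by rewrite all_map; apply: sub_all mss_gt0 => ms ?; apply/all_hairP; exists ms.
elim: ts => [|t ts IH] /=; first by exists [::].
case/andP=> /all_hairP[ms ms_gt0 ->] /IH[mss mss_gt0 ->].
by exists (ms :: mss); rewrite //= ms_gt0.
Qed.

(** The single node [a] is also an Elena tree, but its size is 1. *)
Lemma elena_treesP n W : elena_trees (n + 2) W <->
  exists2 t, all good t & W = a :: t ++ [:: a] /\ elena_size t = n.
Proof.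
split=> [[[mss mss_gt0 ->]]|[t good_t [-> st]]]; last first.
  split; last by rewrite elena_size_ends st.
  have /all_all_hairP[mss mss_gt0 E] :
    all (all hair) ((strands t).1 :: (strands t).2) by apply: hairy_strands.
  exists mss => //; rewrite -[in LHS](strandsK t) /join.
  have -> : [seq a :: [seq p m | m <- ms] | ms <- mss]
          = [seq a :: u | u <- [seq [seq p m | m <- ms] | ms <- mss]].
    by rewrite -map_comp.
  by rewrite -E.
case: mss mss_gt0 => [|ms mss] mss_gt0.
  by rewrite /elena_size /= big_seq1 addn2.
set ts := [seq [seq p m | m <- ms'] | ms' <- mss].
have hairy_d : hairy ([seq p m | m <- ms], ts).
  by apply/(all_all_hairP (_ :: _)); exists (ms :: mss).
have -> : flatten [seq a :: [seq p m | m <- ms'] | ms' <- ms :: mss]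
        = a :: join ([seq p m | m <- ms], ts).
  by rewrite /join /ts -map_comp.
rewrite cat_cons elena_size_ends => /addIn st.
by exists (join ([seq p m | m <- ms], ts)); rewrite // good_join.
Qed.

Lemma A3P n P :
  A3 n P <-> exists2 t, all good t & P = expand t /\ elena_size t = n.
Proof.
split=> [[sP hP /closed_path_expand]|[t good_t [-> st]]].
  case=> // t good_t E; exists t => //; split=> //.
  by move: sP; rewrite E size_expand // => /eqP; rewrite eqn_pmul2l // => /eqP.
by rewrite /A3 /= size_expand // st height_expand in_stripE confined_expand.
Qed.

Theorem mainTheorem2 (n : nat) :
  [/\ forall P : lpath, A3 n P ->
        exists! d : lpath * seq lpath, UD_decomposition P d.1 d.2,
      forall w : lpath, low_loop w ->
        exists! qs : seq lpath, cut_at_returns w qs,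
      forall (w : lpath) (qs : seq lpath), low_loop w -> cut_at_returns w qs ->
        exists! ms : seq nat, all (leq 1) ms /\ qs = [seq sojourn m | m <- ms]
    & exists Phi : lpath -> word,
        (forall P : lpath, A3 n P ->
           forall W : word, elena_graph P W <-> W = Phi P) /\
        set_bij (A3 n) (elena_trees (n + 2)) Phi].
Proof.
split.
- move=> P /A3P[t good_t [-> _]].
  exists (expand (strands t).1, map expand (strands t).2); split.
    apply/UD_decompositionP; exists (strands t); first exact: hairy_strands.
    by rewrite strandsK.
  case=> w0 ws /UD_decompositionP[d hd [/= -> -> E]].
  by rewrite (expand_inj good_t (good_join hd) E) joinK //; case: d {hd E}.
- move=> w /low_loop_cut[ms _ cut]; exists [seq sojourn m | m <- ms].
  by split=> // qs; apply: cut_at_returns_unique cut.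
- move=> w qs /low_loop_cut[ms ms_gt0 cut] /(cut_at_returns_unique cut) <-.
  by exists ms; split=> // ms' [ms'_gt0]; apply: map_sojourn_inj.
have [P|Phi PhiE] := @boolp.choice lpath word (fun P W =>
    forall t, all good t -> P = expand t -> W = a :: t ++ [:: a]).
  have [[t good_t ->]|none] := boolp.pselect (exists2 t, all good t & P = expand t).
    by exists (a :: t ++ [:: a]) => u good_u /(expand_inj good_t good_u) <-.
  (* For a path that is not an expansion any value will do. *)
  by exists [::] => t good_t E; case: none; exists t.
exists Phi; split.
  move=> P /A3P[t good_t [E _]] W; rewrite (PhiE _ _ good_t E).
  split=> [/elena_graphP[u good_u [Eu ->]]|->].
    by rewrite (expand_inj good_t good_u) -?E.
  by apply/elena_graphP; exists t.
split.
- move=> P /A3P[t good_t [E st]]; apply/elena_treesP.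
  by exists t => //; rewrite (PhiE _ _ good_t E).
- move=> P Q /set_mem/A3P[t good_t [E _]] /set_mem/A3P[u good_u [F _]].
  rewrite (PhiE _ _ good_t E) (PhiE _ _ good_u F) !cats1 => -[/rcons_inj[tu]].
  by rewrite E F tu.
- move=> W /elena_treesP[t good_t [-> st]]; exists (expand t).
    by apply/A3P; exists t.
  exact: PhiE.
Qed.
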